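(* Suppose $\alpha\beta\gamma\neq0$ and $\alpha'\beta'\gamma'\neq 0$. Then $A(\alpha,\beta,\gamma)\cong A(\alpha',\beta',\gamma')$ as graded $\Bbbk$-algebras if and only if $(\alpha',\beta',\gamma')$ is a cyclic permutation of either $(\alpha,\beta,\gamma)$ or $(-\alpha,-\gamma,-\beta)$.
   Context: $\Bbbk$ is a field of characteristic not $2$ containing a square root of $-1$; the parameters $\alpha,\beta,\gamma,\alpha',\beta',\gamma'\in\Bbbk$ are assumed to have square roots in $\Bbbk$. Write $[x,y]=xy-yx$ and $\{x,y\}=xy+yx$. $A(\alpha,\beta,\gamma)$ is the free algebra $\Bbbk\langle x_0,x_1,x_2,x_3\rangle$ (graded with $\deg x_j=1$) modulo the six relations $$[x_0,x_1]=\alpha\{x_2,x_3\},\quad [x_0,x_2]=\beta\{x_3,x_1\},\quad [x_0,x_3]=\gamma\{x_1,x_2\},$$ $$\{x_0,x_1\}=[x_2,x_3],\quad \{x_0,x_2\}=[x_3,x_1],\quad \{x_0,x_3\}=[x_1,x_2].$$ *)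

(* Defs.v *)
From HB Require Import structures.
From mathcomp Require Import all_boot all_algebra.
From mathcomp Require Import finmap.
From mathcomp Require Import boolp.
From mathcomp Require Import monalg.

Set Implicit Arguments.
Unset Strict Implicit.
Unset Printing Implicit Defensive.

Import GRing.Theory.
Local Open Scope ring_scope.
Local Open Scope quotient_scope.

Definition is_square (R : nzRingType) (z : R) : Prop := exists r : R, r ^+ 2 = z.

Definition cyclic_permutation (T : Type) (s t : seq T) : Prop :=
  exists i : nat, t = rot i s.

Definition commutator (R : nzRingType) (x y : R) : R := x * y - y * x.
Definition anticommutator (R : nzRingType) (x y : R) : R := x * y + y * x.

(* mathcomp's [idealr] and [{ideal_quot _}] only provide quotient rings of
   commutative rings. *)
HB.mixin Record isProperTwoSided (R : nzRingType) (I : R -> bool) := {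
  two_sided1 : 1 \notin I;
  two_sidedM : forall a x b : R, x \in I -> a * x * b \in I
}.

#[short(type="twoSidedIdeal")]
HB.structure Definition TwoSidedIdeal (R : nzRingType) :=
  {I of GRing.ZmodClosed R I & isProperTwoSided R I}.

Section QuotientAlgebra.

Variables (k : nzRingType) (R : algType k) (I : twoSidedIdeal R).

Definition quotalg : Type := Quotient.quot I.

HB.instance Definition _ := GRing.Zmodule.on quotalg.
HB.instance Definition _ := EqQuotient.on quotalg.

Definition qclass (u : R) : quotalg := \pi_quotalg u.

Lemma qclassP u v : reflect (qclass u = qclass v) (u - v \in I).
Proof. by rewrite Quotient.idealrBE; exact: eqP. Qed.

Lemma qclassK (x : quotalg) : qclass (repr x) = x.
Proof. exact: reprK. Qed.

Lemma qclassD u v : qclass (u + v) = qclass u + qclass v.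
Proof. exact: Quotient.pi_add. Qed.

Definition quot_one : quotalg := qclass 1.
Definition quot_mul (x y : quotalg) : quotalg := qclass (repr x * repr y).
Definition quot_scale (c : k) (x : quotalg) : quotalg := qclass (c *: repr x).

Lemma repr_qclass u : repr (qclass u) - u \in I.
Proof. by apply/qclassP; rewrite qclassK. Qed.

Lemma qclass_mul u v : quot_mul (qclass u) (qclass v) = qclass (u * v).
Proof.
apply/qclassP.
have -> : repr (qclass u) * repr (qclass v) - u * v =
  1 * (repr (qclass u) - u) * repr (qclass v) +
  u * (repr (qclass v) - v) * 1.
  by rewrite mul1r mulr1 mulrBl mulrBr addrA subrK.
by apply: rpredD; apply: two_sidedM; exact: repr_qclass.
Qed.

Lemma qclass_scale c u : quot_scale c (qclass u) = qclass (c *: u).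
Proof.
apply/qclassP; rewrite -scalerBr.
have -> v : c *: v = c *: 1 * v * 1 :> R by rewrite mulr1 -scalerAl mul1r.
by apply: two_sidedM; exact: repr_qclass.
Qed.

Lemma quot_mulA : associative quot_mul.
Proof.
move=> x y z; rewrite -[x]qclassK -[y]qclassK -[z]qclassK.
by rewrite !qclass_mul mulrA.
Qed.

Lemma quot_mul1l : left_id quot_one quot_mul.
Proof. by move=> x; rewrite -[x]qclassK qclass_mul mul1r. Qed.

Lemma quot_mul1r : right_id quot_one quot_mul.
Proof. by move=> x; rewrite -[x]qclassK qclass_mul mulr1. Qed.

Lemma quot_mulDl : left_distributive quot_mul +%R.
Proof.
move=> x y z; rewrite -[x]qclassK -[y]qclassK -[z]qclassK.
by rewrite !qclass_mul -!qclassD qclass_mul mulrDl.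
Qed.

Lemma quot_mulDr : right_distributive quot_mul +%R.
Proof.
move=> x y z; rewrite -[x]qclassK -[y]qclassK -[z]qclassK.
by rewrite !qclass_mul -!qclassD qclass_mul mulrDr.
Qed.

Lemma qclass0 : qclass 0 = 0.
Proof. by apply: (addrI (qclass 0)); rewrite -qclassD !addr0. Qed.

Lemma quot_one_neq0 : quot_one != 0.
Proof.
apply/eqP; rewrite -qclass0 => /qclassP.
by rewrite subr0; apply/negP; exact: two_sided1.
Qed.

HB.instance Definition _ := GRing.Zmodule_isNzRing.Build quotalg
  quot_mulA quot_mul1l quot_mul1r quot_mulDl quot_mulDr quot_one_neq0.

Lemma quot_scaleA c d (x : quotalg) :
  quot_scale c (quot_scale d x) = quot_scale (c * d) x.
Proof. by rewrite -[x]qclassK !qclass_scale scalerA. Qed.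

Lemma quot_scale1 : left_id 1 quot_scale.
Proof. by move=> x; rewrite -[x]qclassK qclass_scale scale1r. Qed.

Lemma quot_scaleDr : right_distributive quot_scale +%R.
Proof.
move=> c x y; rewrite -[x]qclassK -[y]qclassK.
by rewrite !qclass_scale -!qclassD qclass_scale scalerDr.
Qed.

Lemma quot_scaleDl (x : quotalg) : {morph quot_scale^~ x : c d / c + d}.
Proof.
move=> c d; rewrite -[x]qclassK.
by rewrite !qclass_scale -qclassD scalerDl.
Qed.

HB.instance Definition _ := GRing.Zmodule_isLmodule.Build k quotalg
  quot_scaleA quot_scale1 quot_scaleDr quot_scaleDl.

Lemma qclass_is_zmod_morphism : zmod_morphism qclass.
Proof. by move=> u v; apply: (addIr (qclass v)); rewrite -qclassD !subrK. Qed.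

Lemma qclass_is_monoid_morphism : monoid_morphism qclass.
Proof. by split=> [|u v]; rewrite -?qclass_mul. Qed.

Lemma qclass_is_scalable : scalable qclass.
Proof. by move=> c u; rewrite -qclass_scale. Qed.

HB.instance Definition _ :=
  GRing.isZmodMorphism.Build R quotalg qclass qclass_is_zmod_morphism.
HB.instance Definition _ :=
  GRing.isMonoidMorphism.Build R quotalg qclass qclass_is_monoid_morphism.
HB.instance Definition _ :=
  GRing.isScalable.Build k R quotalg *:%R qclass qclass_is_scalable.

Lemma quot_scaleAl c (x y : quotalg) : c *: (x * y) = c *: x * y.
Proof.
rewrite -[x]qclassK -[y]qclassK.
by rewrite -rmorphM -!linearZ -rmorphM /= scalerAl.
Qed.

HB.instance Definition _ :=
  GRing.Lmodule_isLalgebra.Build k quotalg quot_scaleAl.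

Lemma quot_scaleAr c (x y : quotalg) : c *: (x * y) = x * (c *: y).
Proof.
rewrite -[x]qclassK -[y]qclassK.
by rewrite -rmorphM -!linearZ -rmorphM /= scalerAr.
Qed.

HB.instance Definition _ :=
  GRing.Lalgebra_isAlgebra.Build k quotalg quot_scaleAr.

End QuotientAlgebra.

Section GeneratedIdeal.

Variables (R : nzRingType) (s : seq R).

Inductive in_ideal : R -> Prop :=
| ideal_gen x : x \in s -> in_ideal x
| ideal_zero : in_ideal 0
| ideal_sub x y : in_ideal x -> in_ideal y -> in_ideal (x - y)
| ideal_mul a x b : in_ideal x -> in_ideal (a * x * b).

Definition generated_ideal : {pred R} := fun x => `[< in_ideal x >].

Lemma generated_idealP x : reflect (in_ideal x) (x \in generated_ideal).
Proof. exact: asboolP. Qed.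

Lemma generated_ideal_zmod : zmod_closed generated_ideal.
Proof.
split; first by apply/generated_idealP; exact: ideal_zero.
move=> u v /generated_idealP su /generated_idealP sv.
by apply/generated_idealP; exact: ideal_sub.
Qed.

Lemma generated_idealM a x b :
  x \in generated_ideal -> a * x * b \in generated_ideal.
Proof.
by move=> /generated_idealP ?; apply/generated_idealP; exact: ideal_mul.
Qed.

Lemma generated_ideal1 (S : nzRingType) (f : {rmorphism R -> S}) :
  {in s, forall x, f x = 0} -> 1 \notin generated_ideal.
Proof.
move=> f_s; apply/generated_idealP => s1.
have f0 x : in_ideal x -> f x = 0.
  elim=> {x} [x /f_s //||x y _ fx0 _ fy0|a x b _ fx0].
  - by rewrite rmorph0.
  - by rewrite rmorphB fx0 fy0 subrr.
  - by rewrite !rmorphM fx0 mulr0 mul0r.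
by have /eqP := f0 _ s1; rewrite rmorph1 oner_eq0.
Qed.

End GeneratedIdeal.

(* [{fmonom 'I_n}] is the free monoid on n letters, whose monoid algebra is the
   free associative algebra on n generators. *)
Definition freealg (k : comNzRingType) (n : nat) : Type :=
  {malg k[{fmonom 'I_n}]}.

Section FreeAlgebra.

Variables (k : comNzRingType) (n : nat).

HB.instance Definition _ := GRing.Lalgebra.on (freealg k n).

Lemma freealg_scaleAr c (u v : freealg k n) : c *: (u * v) = u * (c *: v).
Proof.
apply/malgP=> m; rewrite [LHS]mcoeffZ [in LHS]mcoeffMl.
rewrite (mcoeffMlw m (fsubset_refl (msupp u)) (msuppZ_le c v)) mulr_sumr.
apply: eq_bigr => m1 _; rewrite mulr_sumr.
by apply: eq_bigr => m2 _; rewrite mcoeffZ mulrnAr mulrCA.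
Qed.

HB.instance Definition _ :=
  GRing.Lalgebra_isAlgebra.Build k (freealg k n) freealg_scaleAr.

Definition freegen (i : 'I_n) : freealg k n := << fmu i >>.

Definition augmentation (u : freealg k n) : k := mcoeff mone u.

Fact augmentation_is_monoid_morphism : monoid_morphism augmentation.
Proof.
by have [augM aug1] := @mcoeff1g_is_multiplicative {fmonom 'I_n} k.
Qed.

HB.instance Definition _ := GRing.isZmodMorphism.Build (freealg k n) k
  augmentation (fun u v => mcoeffB mone u v).
HB.instance Definition _ := GRing.isMonoidMorphism.Build (freealg k n) k
  augmentation augmentation_is_monoid_morphism.

Lemma augmentationZ c u : augmentation (c *: u) = c * augmentation u.
Proof. exact: mcoeffZ. Qed.

Lemma augmentation_gen i : augmentation (freegen i) = 0.
Proof. by rewrite /augmentation mcoeffU1 -fdeg_eq0 fdegU. Qed.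

End FreeAlgebra.

Section Relations.

Variables (k : nzRingType) (R : lalgType k) (alpha beta gamma : k).
Variables (x0 x1 x2 x3 : R).

Definition relations : seq R :=
  [:: commutator x0 x1 - alpha *: anticommutator x2 x3;
      commutator x0 x2 - beta *: anticommutator x3 x1;
      commutator x0 x3 - gamma *: anticommutator x1 x2;
      anticommutator x0 x1 - commutator x2 x3;
      anticommutator x0 x2 - commutator x3 x1;
      anticommutator x0 x3 - commutator x1 x2 ].

Lemma relations_eq0 (f : {rmorphism R -> k}) :
  (forall c u, f (c *: u) = c * f u) ->
  f x0 = 0 -> f x1 = 0 -> f x2 = 0 -> f x3 = 0 ->
  {in relations, forall r, f r = 0}.
Proof.
move=> fZ f0 f1 f2 f3 r.
have comm0 u v : f u = 0 -> f (commutator u v) = 0.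
  by move=> fu0; rewrite rmorphB !rmorphM /= fu0 mul0r mulr0 subrr.
have anti0 u v : f u = 0 -> f (anticommutator u v) = 0.
  by move=> fu0; rewrite rmorphD !rmorphM /= fu0 mul0r mulr0 addr0.
rewrite !inE => /or4P[/eqP->|/eqP->|/eqP->|/or3P[]/eqP->];
  by rewrite rmorphB ?fZ comm0 // anti0 // ?mulr0 subrr.
Qed.

End Relations.

Section FourGenerators.

Variables (k : fieldType) (alpha beta gamma : k).

Definition A_relations : seq (freealg k 4) :=
  relations alpha beta gamma
    (freegen k (@Ordinal 4 0 isT)) (freegen k (@Ordinal 4 1 isT))
    (freegen k (@Ordinal 4 2 isT)) (freegen k (@Ordinal 4 3 isT)).

Definition A_ideal : {pred freealg k 4} := generated_ideal A_relations.

Fact A_ideal_zmod : zmod_closed A_ideal.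
Proof. exact: generated_ideal_zmod. Qed.

Fact A_ideal1 : 1 \notin A_ideal.
Proof.
apply: (generated_ideal1 (f := @augmentation k 4)).
by apply: relations_eq0; [exact: augmentationZ|exact: augmentation_gen..].
Qed.

HB.instance Definition _ :=
  GRing.isZmodClosed.Build (freealg k 4) A_ideal A_ideal_zmod.
HB.instance Definition _ := isProperTwoSided.Build (freealg k 4) A_ideal
  A_ideal1 (@generated_idealM _ A_relations).

Definition algA : algType k := quotalg A_ideal.

Definition homogeneous (n : nat) (x : algA) : Prop :=
  exists2 u : freealg k 4,
    (forall m, m \in msupp u -> fdeg m = n) & x = qclass A_ideal u.

End FourGenerators.

Definition graded_isomorphic (k : fieldType)
    (alpha beta gamma alpha' beta' gamma' : k) : Prop :=
  exists2 f : {lrmorphism algA alpha beta gamma -> algA alpha' beta' gamma'},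
    bijective f & forall n x, homogeneous n x <-> homogeneous n (f x).

(* Main.v *)
From HB Require Import structures.
Require Import Defs.
From mathcomp Require Import all_boot all_algebra.
From mathcomp Require Import finmap monalg zify ring.

(** A graded isomorphism f is determined by the linear map it induces on
    degree 1, and two observations tie this map to the parameters.

    First, it is monomial.  A homomorphism from the algebra to k is a point p
    of k^4 on which the relations vanish; since everything commutes in k, the
    commutators disappear and, as 2, a, b and c are invertible, the relations
    say p_i p_j = 0 for i <> j ([commutative_point]).  So the points of the
    algebra are exactly the four coordinate axes, and f has to permute them:
    f (x_i) is a nonzero multiple of x'_(t i) for a permutation t
    ([injective_degree1_monomial]).  This argument works for all nonzero
    parameters, including those for which the algebra is degenerate.

    Second, the parameter a can be read off from the pair of relations
    [x0, x1] = a {x2, x3}, {x0, x1} = [x2, x3], up to a sign governed by the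
    order of the generators.  Rescaling the four generators turns it into
    [x0, x1] = (a c) {x2, x3}, {x0, x1} = c [x2, x3] with c <> 0, which is
    [pair_relation].  In this relaxed form the relation is stable under
    exchanging the two pairs, and changes a to - a when one pair is reversed.
    Consequently the three relaxed relations, indexed by the three ways of
    splitting the generators into pairs, are stable under all permutations of
    the generators, provided that (a, b, c) is moved accordingly: the Klein
    four-group acts trivially, a 3-cycle rotates (a, b, c), and a transposition
    gives (- a, - c, - b) up to rotation.  Undoing t, the generators x' in
    their standard order satisfy the relaxed relations for some triple in the
    class of (a, b, c) ([quad_relation_reorder]).  They also satisfy the strict
    relations for (a', b', c'), and the products [x2, x3], {x2, x3} and their
    rotations do not vanish in the algebra ([gen_products_neq0], seen in an
    explicit nilpotent matrix representation); hence the two triples agree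
    ([quad_relation_gen]).

    Conversely a rotation of x1, x2, x3 rotates the parameters, while
    exchanging x2 and x3 and replacing x0 by - x0 realizes
    (a, b, c) |-> (- a, - c, - b). *)

Set Implicit Arguments.
Unset Strict Implicit.
Unset Printing Implicit Defensive.

Import GRing.Theory.
Local Open Scope ring_scope.

(** * The universal property of the free algebra *)

Section Substitution.

Variables (k : comNzRingType) (n : nat) (B : algType k) (y : 'I_n -> B).

Definition word_value (m : {fmonom 'I_n}) : B :=
  \prod_(i <- (m : seq 'I_n)) y i.

Fact word_value_mmorphism : mmorphism word_value.
Proof.
split=> [u v|]; rewrite /word_value ?fm1 ?big_nil //.
by rewrite fmM big_cat.
Qed.

HB.instance Definition _ :=
  isMultiplicative.Build {fmonom 'I_n} B word_value word_value_mmorphism.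

Definition substitution (u : freealg k n) : B := mmap (in_alg B) word_value u.

Fact substitution_zmod : zmod_morphism substitution.
Proof. exact: mmap_is_additive. Qed.

Fact substitution_monoid : monoid_morphism substitution.
Proof.
have [M1 M2] : multiplicative substitution.
  apply: commr_mmap_is_multiplicative => g m m'.
  by rewrite /GRing.comm /= -scalerAl mul1r -scalerAr mulr1.
by split.
Qed.

Fact substitution_scalable : scalable substitution.
Proof. by move=> c u; rewrite /substitution mmapZ /= -scalerAl mul1r. Qed.

HB.instance Definition _ := GRing.isZmodMorphism.Build (freealg k n) B
  substitution substitution_zmod.
HB.instance Definition _ := GRing.isMonoidMorphism.Build (freealg k n) B
  substitution substitution_monoid.
HB.instance Definition _ := GRing.isScalable.Build k (freealg k n) B *:%R
  substitution substitution_scalable.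

Lemma substitution_gen i : substitution (freegen k i) = y i.
Proof.
rewrite /substitution mmapU /= scale1r mul1r /word_value fmuE /=.
by rewrite big_seq1.
Qed.

Lemma substitutionE (u : freealg k n) :
  substitution u = \sum_(m <- msupp u) mcoeff m u *: word_value m.
Proof.
rewrite /substitution /mmap; apply: eq_bigr => m _.
by rewrite /= -scalerAl mul1r.
Qed.

End Substitution.

Lemma morph_substitution (k : comNzRingType) (n : nat) (B C : algType k)
    (f : {lrmorphism B -> C}) (y : 'I_n -> B) u :
  f (substitution y u) = substitution (fun i => f (y i)) u.
Proof.
rewrite !substitutionE raddf_sum; apply: eq_bigr => m _.
by rewrite [LHS]linearZZ rmorph_prod.
Qed.

Lemma malgUZ (k : comNzRingType) (K : monomType) (c : k) (m : K) :
  << c *g m >> = c *: << m >> :> {malg k[K]}.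
Proof. by rewrite -[RHS]mul_malgC [RHS]malgM_def fgmulUU mul1m mulr1. Qed.

Lemma malgUM (k : comNzRingType) (K : monomType) (m1 m2 : K) :
  << mmul m1 m2 >> = << m1 >> * << m2 >> :> {malg k[K]}.
Proof. by rewrite [RHS]malgM_def fgmulUU mulr1. Qed.

Lemma word_value_freegen (k : comNzRingType) (n : nat) (m : {fmonom 'I_n}) :
  word_value (@freegen k n) m = << m >>.
Proof.
case: m => s; rewrite /word_value /=; elim: s => [|i s IHs].
  by rewrite big_nil -fmoneE.
have -> : FMonom (i :: s) = mmul (fmu i) (FMonom s).
  by apply/eqP; rewrite fmP fmM fmU.
by rewrite big_cons IHs malgUM.
Qed.

Lemma substitution_freegen (k : comNzRingType) (n : nat) (u : freealg k n) :
  substitution (@freegen k n) u = u.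
Proof.
rewrite substitutionE [RHS](monalgE u); apply: eq_bigr => m _.
rewrite word_value_freegen; symmetry.
exact: malgUZ.
Qed.

(** * The presentation of the algebra by generators and relations *)

Definition gen (k : fieldType) (a b c : k) (i : 'I_4) : algA a b c :=
  qclass (A_ideal a b c) (freegen k i).

Local Notation i0 := (@Ordinal 4 0 isT).
Local Notation i1 := (@Ordinal 4 1 isT).
Local Notation i2 := (@Ordinal 4 2 isT).
Local Notation i3 := (@Ordinal 4 3 isT).

(** By [algA_universal], the tuples y with this property are the same thing as
    homomorphisms from the algebra to B. *)
Definition satisfies (k : nzRingType) (B : lalgType k) (a b c : k)
    (y : 'I_4 -> B) : Prop :=
  {in relations a b c (y i0) (y i1) (y i2) (y i3), forall r, r = 0}.

Lemma satisfiesP (k : nzRingType) (B : lalgType k) (a b c : k) (y : 'I_4 -> B) :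
  satisfies a b c y <->
  [/\ commutator (y i0) (y i1) = a *: anticommutator (y i2) (y i3),
      commutator (y i0) (y i2) = b *: anticommutator (y i3) (y i1)
    & commutator (y i0) (y i3) = c *: anticommutator (y i1) (y i2)] /\
  [/\ anticommutator (y i0) (y i1) = commutator (y i2) (y i3),
      anticommutator (y i0) (y i2) = commutator (y i3) (y i1)
    & anticommutator (y i0) (y i3) = commutator (y i1) (y i2)].
Proof.
split=> [rel|[[ra rb rc] [ua ub uc]] r].
  by split; split; apply: subr0_eq; apply: rel; rewrite !inE eqxx ?orbT.
rewrite !inE => /or4P[/eqP->|/eqP->|/eqP->|/or3P[]/eqP->]; apply/eqP.
all: by rewrite subr_eq0; apply/eqP.
Qed.

Lemma morph_commutator (k : nzRingType) (B C : lalgType k)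
    (f : {lrmorphism B -> C}) x y :
  f (commutator x y) = commutator (f x) (f y).
Proof. by rewrite rmorphB !rmorphM. Qed.

Lemma morph_anticommutator (k : nzRingType) (B C : lalgType k)
    (f : {lrmorphism B -> C}) x y :
  f (anticommutator x y) = anticommutator (f x) (f y).
Proof. by rewrite rmorphD !rmorphM. Qed.

Lemma map_relations (k : nzRingType) (B C : lalgType k)
    (f : {lrmorphism B -> C}) (a b c : k) (y0 y1 y2 y3 : B) :
  map f (relations a b c y0 y1 y2 y3) =
  relations a b c (f y0) (f y1) (f y2) (f y3).
Proof.
have fBZ d u v : f (u - d *: v) = f u - d *: f v.
  by rewrite rmorphB [X in _ - X]linearZZ.
have fBB u v : f (u - v) = f u - f v := rmorphB f u v.
rewrite /relations /= !fBZ !(fBB (anticommutator _ _)).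
by rewrite !morph_commutator !morph_anticommutator.
Qed.

Lemma satisfies_morph (k : nzRingType) (B C : lalgType k)
    (f : {lrmorphism B -> C}) (a b c : k) (y : 'I_4 -> B) :
  satisfies a b c y -> satisfies a b c (fun i => f (y i)).
Proof.
move=> y_rel r; rewrite -map_relations => /mapP[u /y_rel-> ->].
exact: rmorph0.
Qed.

Section Presentation.

Variables (k : fieldType) (a b c : k).

Lemma gen_satisfies : satisfies a b c (gen a b c).
Proof.
move=> r; rewrite -map_relations => /mapP[u u_rel ->].
rewrite -(qclass0 (A_ideal a b c)); apply/qclassP; rewrite subr0.
by apply/generated_idealP; exact: ideal_gen.
Qed.

Lemma algA_universal (B : algType k) (y : 'I_4 -> B) :
  satisfies a b c y ->
  exists f : {lrmorphism algA a b c -> B},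
    forall i, f (gen a b c i) = y i.
Proof.
move=> y_rel.
pose q := qclass (A_ideal a b c).
have killed u : u \in A_ideal a b c -> substitution y u = 0.
  move=> /generated_idealP; elim=> {u} [u u_rel||u v _ fu0 _ fv0|u v w _ fv0].
  - apply: y_rel; rewrite -!(substitution_gen y) -map_relations.
    exact: map_f.
  - by rewrite rmorph0.
  - by rewrite rmorphB /= fu0 fv0 subrr.
  - by rewrite !rmorphM /= fv0 mulr0 mul0r.
pose F (x : algA a b c) : B := substitution y (repr x).
have Fq u : F (q u) = substitution y u.
  by apply/eqP; rewrite -subr_eq0 -rmorphB /= killed // repr_qclass.
have Fz : zmod_morphism F.
  by move=> u v; rewrite -[u]qclassK -[v]qclassK -rmorphB /= !Fq [LHS]rmorphB.
have Fm : monoid_morphism F.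
  split=> [|u v]; first by rewrite -(rmorph1 q) Fq rmorph1.
  by rewrite -[u]qclassK -[v]qclassK -rmorphM /= !Fq [LHS]rmorphM.
have Fs : scalable F.
  by move=> d u; rewrite -[u]qclassK -linearZ /= !Fq [LHS]linearZZ.
pose Fi1 := GRing.isZmodMorphism.Build _ _ F Fz.
pose Fi2 := GRing.isMonoidMorphism.Build _ _ F Fm.
pose Fi3 := GRing.isScalable.Build _ _ _ _ F Fs.
pose FF : {lrmorphism algA a b c -> B} := HB.pack F Fi1 Fi2 Fi3.
by exists FF => i; rewrite -(substitution_gen y i); exact: Fq.
Qed.

End Presentation.

(** * Homogeneous elements and graded homomorphisms *)

Section Degrees.

Variables (k : fieldType) (a b c : k).
Implicit Types x y : algA a b c.

Lemma homogeneousD n x y :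
  homogeneous n x -> homogeneous n y -> homogeneous n (x + y).
Proof.
move=> [u u_n ->] [v v_n ->]; exists (u + v); last by rewrite rmorphD.
by move=> m /(fsubsetP (msuppD_le u v)); rewrite in_fsetU => /orP[/u_n|/v_n].
Qed.

Lemma homogeneousZ n d x : homogeneous n x -> homogeneous n (d *: x).
Proof.
move=> [u u_n ->]; exists (d *: u); last by rewrite linearZZ.
by move=> m /(fsubsetP (msuppZ_le d u)) /u_n.
Qed.

Lemma homogeneousM n p x y :
  homogeneous n x -> homogeneous p y -> homogeneous (n + p) (x * y).
Proof.
move=> [u u_n ->] [v v_p ->]; exists (u * v); last by rewrite rmorphM.
by move=> m /msuppM_le[m1 [m2 [/u_n <- /v_p <- ->]]]; rewrite fdegM.
Qed.

Lemma homogeneous0 n : homogeneous n (0 : algA a b c).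
Proof. by exists 0; [move=> m; rewrite msupp0|rewrite rmorph0]. Qed.

Lemma homogeneous_one : homogeneous 0 (1 : algA a b c).
Proof.
exists 1; last by rewrite rmorph1.
move=> m; rewrite -mcoeff_neq0 mcoeff1.
by case: (m =P mone) => [-> _|_]; rewrite ?fdeg1 ?eqxx.
Qed.

Lemma homogeneous_gen i : homogeneous 1 (gen a b c i).
Proof.
exists (freegen k i) => // m; rewrite msuppU1 in_fset1 => /eqP->.
exact: fdegU.
Qed.

Lemma homogeneous1P x :
  homogeneous 1 x -> exists p : 'I_4 -> k, x = \sum_i p i *: gen a b c i.
Proof.
case=> u u1 ->; exists (fun i => mcoeff (fmu i) u).
have {1}-> : u = \sum_i mcoeff (fmu i) u *: freegen k i.
  apply/malgP => m; rewrite raddf_sum /=.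
  under eq_bigr => i _ do rewrite mcoeffZ mcoeffU1.
  have [m1|m1] := boolP (m \in msupp u); last first.
    rewrite (mcoeff_outdom m1) big1 // => i _.
    by case: eqP => [->|]; rewrite ?(mcoeff_outdom m1) ?mul0r ?mulr0.
  have := u1 m m1; case: m {m1} => [[|i []]] // _.
  rewrite -fmuE (bigD1 i) //= eqxx mulr1 big1 ?addr0 // => j /negPf ij.
  by rewrite fmP !fmU eqseq_cons ij mulr0.
rewrite raddf_sum; apply: eq_bigr => i _.
by rewrite [LHS]linearZZ.
Qed.

Lemma morph_qclassE (B : algType k) (f : {lrmorphism algA a b c -> B}) u :
  f (qclass (A_ideal a b c) u) = substitution (fun i => f (gen a b c i)) u.
Proof.
rewrite -{1}(substitution_freegen u) morph_substitution.
exact: morph_substitution.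
Qed.

End Degrees.

(** A homomorphism sending generators to degree 1 sends words of length n to
    products of n elements of degree 1. *)
Lemma homogeneous_morph (k : fieldType) (a b c a' b' c' : k)
    (f : {lrmorphism algA a b c -> algA a' b' c'}) n x :
  (forall i, homogeneous 1 (f (gen a b c i))) ->
  homogeneous n x -> homogeneous n (f x).
Proof.
move=> f1 [u u_n ->]; rewrite morph_qclassE substitutionE.
rewrite big_seq; apply: (big_ind (homogeneous n)).
- exact: homogeneous0.
- exact: homogeneousD.
move=> m /u_n <-; apply: homogeneousZ.
case: m => s; rewrite /word_value /fdeg /=.
elim: s => [|i s IHs]; first by rewrite big_nil; exact: homogeneous_one.
by rewrite big_cons; exact: homogeneousM (f1 i) IHs.
Qed.

Lemma morph_cancel (k : fieldType) (a b c a' b' c' : k)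
    (f : {lrmorphism algA a b c -> algA a' b' c'})
    (g : {lrmorphism algA a' b' c' -> algA a b c}) :
  (forall i, g (f (gen a b c i)) = gen a b c i) -> cancel f g.
Proof.
move=> gfE x; rewrite -[x]qclassK.
apply: (etrans (congr1 g (morph_qclassE f (repr x)))).
apply: (etrans (morph_substitution g _ _)).
rewrite -[in RHS](substitution_freegen (repr x)).
rewrite [RHS](morph_substitution (qclass (A_ideal a b c))).
rewrite !substitutionE; apply: eq_bigr => m _; congr (_ *: _).
by apply: eq_bigr => i _; exact: gfE.
Qed.

(** * Graded isomorphisms that permute and rescale the generators *)

Section GradedIsomorphism.

Variable k : fieldType.
Implicit Types a b c : k.

Lemma graded_isomorphic_refl a b c : graded_isomorphic a b c a b c.
Proof.
by exists (idfun : {lrmorphism algA a b c -> algA a b c}) => //; exists idfun.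
Qed.

Lemma graded_isomorphic_trans a b c a' b' c' a'' b'' c'' :
  graded_isomorphic a b c a' b' c' -> graded_isomorphic a' b' c' a'' b'' c'' ->
  graded_isomorphic a b c a'' b'' c''.
Proof.
move=> [f f_bij f_deg] [g g_bij g_deg].
exists (g \o f : {lrmorphism _ -> _}) => [|n x]; first exact: bij_comp.
by rewrite /= -g_deg.
Qed.

Lemma monomial_cancel (A B : algType k) (f : {lrmorphism A -> B})
    (g : {lrmorphism B -> A}) (x : 'I_4 -> A) (y : 'I_4 -> B)
    (s t : 'I_4 -> 'I_4) (e d : 'I_4 -> k) :
  (forall i, f (x i) = e i *: y (s i)) ->
  (forall i, g (y i) = d i *: x (t i)) ->
  cancel s t -> (forall i, e i * d (s i) = 1) -> forall i, g (f (x i)) = x i.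
Proof.
by move=> fE gE sK ed i; rewrite fE linearZZ /= gE scalerA ed sK scale1r.
Qed.

Lemma graded_isomorphic_monomial a b c a' b' c' (s t : 'I_4 -> 'I_4)
    (e d : 'I_4 -> k) :
  cancel s t -> cancel t s ->
  (forall i, e i * d (s i) = 1) -> (forall i, d i * e (t i) = 1) ->
  satisfies a b c (fun i => e i *: gen a' b' c' (s i)) ->
  satisfies a' b' c' (fun i => d i *: gen a b c (t i)) ->
  graded_isomorphic a b c a' b' c'.
Proof.
move=> sK tK ed de /algA_universal[f fE] /algA_universal[g gE].
have fK : cancel f g by apply/morph_cancel/(monomial_cancel fE gE).
have gK : cancel g f by apply/morph_cancel/(monomial_cancel gE fE).
have f1 i : homogeneous 1 (f (gen a b c i)).
  by rewrite fE; apply/homogeneousZ/homogeneous_gen.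
have g1 i : homogeneous 1 (g (gen a' b' c' i)).
  by rewrite gE; apply/homogeneousZ/homogeneous_gen.
exists f => [|n x]; first exact: (Bijective fK gK).
split=> [|fx]; first exact: homogeneous_morph.
by rewrite -(fK x); exact: homogeneous_morph.
Qed.

End GradedIsomorphism.

(** * Rotating the parameters, and reversing them with a sign *)

Section RelationSymmetries.

Variables (k : nzRingType) (B : lalgType k).
Implicit Types (a b c : k) (x : B) (y : 'I_4 -> B).

Lemma commutatorC x x' : commutator x x' = - commutator x' x.
Proof. by rewrite /commutator opprB. Qed.

Lemma anticommutatorC x x' : anticommutator x x' = anticommutator x' x.
Proof. by rewrite /anticommutator addrC. Qed.

Lemma commutatorNl x x' : commutator (- x) x' = - commutator x x'.
Proof. by rewrite /commutator mulNr mulrN opprB opprK addrC. Qed.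

Lemma anticommutatorNl x x' : anticommutator (- x) x' = - anticommutator x x'.
Proof. by rewrite /anticommutator mulNr mulrN opprD. Qed.

Definition cycle_index (i : 'I_4) : 'I_4 := nth i0 [:: i0; i2; i3; i1] i.
Definition cycle_index_inv (i : 'I_4) : 'I_4 := nth i0 [:: i0; i3; i1; i2] i.
Definition swap_index (i : 'I_4) : 'I_4 := nth i0 [:: i0; i1; i3; i2] i.

(** Exchanging x2 and x3 changes the sign of the commutators of x1, x2 and x3 in
    the relations {x0, x_i} = [x_j, x_l]; the sign on x0 restores these
    relations. *)
Definition swap_sign (i : 'I_4) : k := nth 0 [:: -1; 1; 1; 1] i.

Lemma satisfies_cycle a b c y :
  satisfies a b c y -> satisfies b c a (fun i => 1 *: y (cycle_index i)).
Proof.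
move=> /satisfiesP[[ra rb rc] [ua ub uc]].
by apply/satisfiesP; rewrite /cycle_index /= !scale1r; split.
Qed.

Lemma satisfies_cycle_inv a b c y :
  satisfies b c a y -> satisfies a b c (fun i => 1 *: y (cycle_index_inv i)).
Proof.
move=> /satisfiesP[[ra rb rc] [ua ub uc]].
by apply/satisfiesP; rewrite /cycle_index_inv /= !scale1r; split.
Qed.

Lemma satisfies_swap a b c y :
  satisfies (- a) (- c) (- b) y ->
  satisfies a b c (fun i => swap_sign i *: y (swap_index i)).
Proof.
move=> /satisfiesP[[ra rb rc] [ua ub uc]].
apply/satisfiesP; rewrite /swap_index /swap_sign /= !scale1r !scaleN1r.
rewrite !commutatorNl !anticommutatorNl ra rb rc ua ub uc.
rewrite !scaleNr !opprK -!commutatorC.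
by split; split=> //; congr (_ *: _); exact: anticommutatorC.
Qed.

End RelationSymmetries.

Section BasicIsomorphisms.

Variables (k : fieldType) (a b c : k).

Lemma graded_isomorphic_cycle : graded_isomorphic a b c b c a.
Proof.
have tK : cancel cycle_index_inv cycle_index.
  by move=> [[|[|[|[|]]]] lti] //; apply: val_inj.
have sK : cancel cycle_index cycle_index_inv.
  by move=> [[|[|[|[|]]]] lti] //; apply: val_inj.
apply: (graded_isomorphic_monomial tK sK (fun=> mulr1 1) (fun=> mulr1 1)).
  exact/satisfies_cycle_inv/gen_satisfies.
exact/satisfies_cycle/gen_satisfies.
Qed.

Lemma graded_isomorphic_swap : graded_isomorphic a b c (- a) (- c) (- b).
Proof.
have sK : cancel swap_index swap_index.
  by move=> [[|[|[|[|]]]] lti] //; apply: val_inj.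
have ee i : swap_sign k i * swap_sign k (swap_index i) = 1.
  by case: i => [[|[|[|[|]]]] lti] //; rewrite /swap_sign /= ?mulrNN mulr1.
apply: (graded_isomorphic_monomial sK sK ee ee).
  exact/satisfies_swap/gen_satisfies.
by apply: satisfies_swap; rewrite !opprK; exact: gen_satisfies.
Qed.

End BasicIsomorphisms.

(** * Points of the algebra and monomiality of isomorphisms *)

Section Points.

Variables (k : fieldType) (a b c : k).

Lemma satisfies_coordinate j : satisfies a b c (fun i => (i == j)%:R : k^o).
Proof.
apply/satisfiesP; rewrite /commutator /anticommutator /=.
case: j => [[|[|[|[|]]]] ltj] //;
  by rewrite -!val_eqE /= !(mulr0, mul0r, subrr, addr0, scaler0).
Qed.

Lemma gen_coordinate j :
  exists chi : {lrmorphism algA a b c -> k^o},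
    forall i, chi (gen a b c i) = (i == j)%:R.
Proof. exact/algA_universal/satisfies_coordinate. Qed.

Lemma coordinate_sum (B : algType k) (x : 'I_4 -> B)
    (chi : {lrmorphism B -> k^o}) j (p : 'I_4 -> k) :
  (forall i, chi (x i) = (i == j)%:R) -> chi (\sum_i p i *: x i) = p j.
Proof.
move=> chiE; rewrite raddf_sum (bigD1 j) //= linearZZ /= chiE eqxx.
rewrite big1 ?addr0 => [|i /negPf ij]; first by rewrite [LHS]mulr1.
by rewrite linearZZ /= chiE ij scaler0.
Qed.

Lemma gen_neq0 i : gen a b c i != 0.
Proof.
have [chi chiE] := gen_coordinate i; apply/eqP => gen0.
by have /eqP := chiE i; rewrite gen0 rmorph0 eqxx eq_sym oner_eq0.
Qed.

(** In k the commutators vanish, so the six relations read p_i p_j = 0, one for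
    each pair of indices: the points of the algebra lie on the axes. *)
Lemma commutative_point (p : 'I_4 -> k^o) :
  2 != 0 :> k -> a * b * c != 0 -> satisfies a b c p ->
  forall i j, i != j -> p i * p j = 0.
Proof.
move=> two0; rewrite !mulf_eq0 !negb_or => /andP[/andP[a0 b0] c0].
have comm0 (x y : k^o) : commutator x y = 0 by rewrite /commutator mulrC subrr.
have anti0 (x y : k^o) : anticommutator x y = 0 -> x * y = 0.
  rewrite /anticommutator (mulrC y) -mulr2n -mulr_natr => /eqP.
  by rewrite mulf_eq0 (negPf two0) orbF => /eqP.
have scal0 d (x y : k^o) : d != 0 -> 0 = d *: anticommutator x y -> x * y = 0.
  move=> d0 /esym/eqP; rewrite scaler_eq0 (negPf d0) => /eqP; exact: anti0.
move=> /satisfiesP; rewrite !comm0.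
move=> [[/(scal0 _ _ _ a0) p23 /(scal0 _ _ _ b0) p31 /(scal0 _ _ _ c0) p12]].
move=> [/anti0 p01 /anti0 p02 /anti0 p03].
suff ltp (i j : 'I_4) : (i < j)%N -> p i * p j = 0.
  by move=> i j; rewrite neq_ltn => /orP[|] /ltp // <-; rewrite mulrC.
case: i => [[|[|[|[|i]]]] lti] //; case: j => [[|[|[|[|j]]]] ltj] // _.
all: rewrite (bool_irrelevance lti isT) (bool_irrelevance ltj isT) //.
by rewrite mulrC.
Qed.

End Points.

Section MonomialImage.

Variables (k : fieldType) (a b c a' b' c' : k).
Variable f : {lrmorphism algA a b c -> algA a' b' c'}.

(** Composing f with the l-th coordinate point of the target gives a point of
    the source, whose coordinates form the l-th column of the matrix G of f in
    degree 1.  So each column of G has at most one nonzero entry, while no row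
    of G vanishes as f is injective: G is a monomial matrix. *)
Lemma injective_degree1_monomial :
  2 != 0 :> k -> a * b * c != 0 -> injective f ->
  (forall i, homogeneous 1 (f (gen a b c i))) ->
  exists2 t : 'I_4 -> 'I_4, injective t &
  exists2 mu : 'I_4 -> k, (forall i, mu i != 0) &
  forall i, gen a' b' c' (t i) = mu i *: f (gen a b c i).
Proof.
move=> two0 abc0 f_inj f1.
have /fin_all_exists[G fE] i := homogeneous1P (f1 i).
have Gcol l i j : i != j -> G i l * G j l = 0.
  have [chi chiE] := gen_coordinate a' b' c' l.
  have chif i' : chi (f (gen a b c i')) = G i' l.
    apply: (etrans (congr1 chi (fE i'))).
    exact: (coordinate_sum _ chiE).
  have f_rel := satisfies_morph (f := f) (@gen_satisfies k a b c).
  have chi_rel := satisfies_morph (f := chi) f_rel.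
  by move=> ij; rewrite -!chif; exact: (commutative_point two0 abc0 chi_rel ij).
have /fin_all_exists[t Gt] i : exists l, G i l != 0.
  apply/existsP; apply: contraT; rewrite negb_exists => /forallP Gi0.
  have /eqP[] := gen_neq0 a b c i; apply: f_inj; rewrite fE rmorph0.
  by apply: big1 => l _; have /negPn/eqP-> := Gi0 l; rewrite scale0r.
have t_inj : injective t.
  move=> i j tij; apply/eqP/contraT => /(Gcol (t i))/eqP.
  by rewrite mulf_eq0 {2}tij !(negPf (Gt _)).
have [u uK tK] := injF_bij t_inj.
exists t => //; exists (fun i => (G i (t i))^-1) => i.
  by rewrite invr_eq0.
rewrite fE (bigD1 (t i)) //= big1 ?addr0 => [|l ti_l].
  by rewrite scalerA mulVf ?scale1r.
(* The nonzero entry of column l = t (u l) is in row u l, which is not i. *)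
have ul_i : u l != i by apply: contraNneq ti_l => <-; rewrite tK.
have := Gt (u l); rewrite tK => G_nz; have /eqP := Gcol l _ _ ul_i.
by rewrite mulf_eq0 (negPf G_nz) => /eqP->; rewrite scale0r.
Qed.

End MonomialImage.

(** * The relations up to rescaling of the generators *)

Section PairRelations.

Variables (k : fieldType) (B : lalgType k).
Implicit Types (a c : k) (x : B).

(** The two relations attached to the splitting of the generators into the
    pairs x0, x1 and x2, x3, as they look after an arbitrary rescaling of the
    generators: replacing x_i by d_i x_i results in c = d0 d1 / (d2 d3). *)
Definition pair_relation a x0 x1 x2 x3 : Prop :=
  exists2 c, c != 0 &
    commutator x0 x1 = (a * c) *: anticommutator x2 x3 /\
    anticommutator x0 x1 = c *: commutator x2 x3.

Lemma pair_relation_swapl a x0 x1 x2 x3 :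
  pair_relation a x0 x1 x2 x3 -> pair_relation (- a) x1 x0 x2 x3.
Proof.
move=> [c c0 [rel rel']]; exists c => //; split.
  by rewrite commutatorC rel mulNr scaleNr.
by rewrite anticommutatorC.
Qed.

Lemma pair_relation_swapr a x0 x1 x2 x3 :
  pair_relation a x0 x1 x2 x3 -> pair_relation (- a) x0 x1 x3 x2.
Proof.
move=> [c c0 [rel rel']]; exists (- c); rewrite ?oppr_eq0 //; split.
  by rewrite mulrNN anticommutatorC.
by rewrite commutatorC scaleNr scalerN opprK.
Qed.

(** Solving both relations for the products of x2 and x3 gives relations of the
    same form, with the same a and with 1 / (a c) as the new constant. *)
Lemma pair_relation_sym a x0 x1 x2 x3 : a != 0 ->
  pair_relation a x0 x1 x2 x3 -> pair_relation a x2 x3 x0 x1.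
Proof.
move=> a0 [c c0 [rel rel']]; exists (a * c)^-1; rewrite ?invr_eq0 ?mulf_neq0 //.
rewrite rel rel' !scalerA mulVf ?mulf_neq0 // scale1r; split=> //.
by rewrite invfM mulrA mulfV // mul1r mulVf // scale1r.
Qed.

End PairRelations.

Section QuadrupleRelations.

Variables (k : fieldType) (B : algType k).
Implicit Types (a b c : k) (x : B).

Lemma commutatorZ (d e : k) x y :
  commutator (d *: x) (e *: y) = (d * e) *: commutator x y.
Proof.
rewrite /commutator -!scalerAl -!scalerAr !scalerA.
by rewrite [e * d]mulrC scalerBr.
Qed.

Lemma anticommutatorZ (d e : k) x y :
  anticommutator (d *: x) (e *: y) = (d * e) *: anticommutator x y.
Proof.
rewrite /anticommutator -!scalerAl -!scalerAr !scalerA.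
by rewrite [e * d]mulrC scalerDr.
Qed.

Lemma pair_relation_rescale a x0 x1 x2 x3 (d0 d1 d2 d3 : k) :
  d0 != 0 -> d1 != 0 -> d2 != 0 -> d3 != 0 ->
  commutator x0 x1 = a *: anticommutator x2 x3 ->
  anticommutator x0 x1 = commutator x2 x3 ->
  pair_relation a (d0 *: x0) (d1 *: x1) (d2 *: x2) (d3 *: x3).
Proof.
move=> d0n d1n d2n d3n rel rel'.
exists (d0 * d1 / (d2 * d3)); first by rewrite !mulf_neq0 ?invr_eq0 ?mulf_neq0.
rewrite !commutatorZ !anticommutatorZ rel rel' !scalerA -!mulrA.
rewrite mulVf ?mulf_neq0 // mulr1; split=> //.
by congr (_ *: _); rewrite mulrA mulrC.
Qed.

Definition quad_relation a b c x0 x1 x2 x3 : Prop :=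
  [/\ pair_relation a x0 x1 x2 x3, pair_relation b x0 x2 x3 x1
    & pair_relation c x0 x3 x1 x2].

Lemma quad_relation_cycle a b c x0 x1 x2 x3 :
  quad_relation a b c x0 x1 x2 x3 -> quad_relation b c a x0 x2 x3 x1.
Proof. by case. Qed.

Lemma quad_relation_swap a b c x0 x1 x2 x3 :
  quad_relation a b c x0 x1 x2 x3 ->
  quad_relation (- a) (- c) (- b) x0 x1 x3 x2.
Proof. by case=> ra rb rc; split; exact: pair_relation_swapr. Qed.

(** Reversing both pairs of a splitting, or exchanging its pairs, preserves its
    parameter: the two signs of a double reversal cancel. *)
Lemma quad_relation_klein a b c x0 x1 x2 x3 :
  a * b * c != 0 ->
  quad_relation a b c x0 x1 x2 x3 -> quad_relation a b c x1 x0 x3 x2.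
Proof.
rewrite !mulf_eq0 !negb_or => /andP[/andP[a0 b0] c0].
have flip d y0 y1 y2 y3 :
    pair_relation d y0 y1 y2 y3 -> pair_relation d y1 y0 y3 y2.
  by rewrite -{2}(opprK d) => /pair_relation_swapl/pair_relation_swapr.
case=> ra rb rc; split; first exact: flip.
  exact/flip/pair_relation_sym.
exact: pair_relation_sym.
Qed.

End QuadrupleRelations.

(** The transposition, the 3-cycle and the double transposition below generate
    the symmetric group, so a property stable under them can be brought from any
    order of the four indices to the standard one: the double transposition and
    the 3-cycle bring 0 to the front, the 3-cycle and the transposition then
    place 1 and 2. *)
Lemma order_quadruple (Q : 'I_4 -> 'I_4 -> 'I_4 -> 'I_4 -> Prop) :
  (forall h i j l, Q h i j l -> Q h i l j) ->
  (forall h i j l, Q h i j l -> Q h j l i) ->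
  (forall h i j l, Q h i j l -> Q i h l j) ->
  forall h i j l, uniq [:: h; i; j; l] -> Q h i j l -> Q i0 i1 i2 i3.
Proof.
move=> swap cyc klein.
have mem_uniq (s : 4.-tuple 'I_4) o : uniq s -> o \in val s.
  move=> s_uniq; have s_card : #|val s| = #|'I_4|.
    by rewrite (card_uniqP s_uniq) size_tuple card_ord.
  by have /(subset_cardP s_card)-> : val s \subset 'I_4 by apply/subsetP.
have Q2 l : uniq [:: i0; i1; i2; l] -> Q i0 i1 i2 l -> Q i0 i1 i2 i3.
  move=> /(mem_uniq [tuple i0; i1; i2; l] i3).
  by rewrite !inE !orFb => /eqP<-.
have Q1 j l : uniq [:: i0; i1; j; l] -> Q i0 i1 j l -> Q i0 i1 i2 i3.
  move=> u; have := mem_uniq [tuple i0; i1; j; l] i2 u.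
  rewrite !inE !orFb => /orP[]/eqP eq2; rewrite -eq2 in u *; first exact: Q2.
  move=> /swap; apply: Q2; rewrite (perm_uniq (s2 := [:: i0; i1; j; i2])) //.
  by apply/permP => P /=; lia.
have Q0 i j l : uniq [:: i0; i; j; l] -> Q i0 i j l -> Q i0 i1 i2 i3.
  move=> u; have := mem_uniq [tuple i0; i; j; l] i1 u.
  rewrite !inE !orFb => /or3P[]/eqP eq1; rewrite -eq1 in u *; first exact: Q1.
    move=> /cyc; apply: Q1; rewrite (perm_uniq (s2 := [:: i0; i; i1; l])) //.
    by apply/permP => P /=; lia.
  move=> /cyc/cyc; apply: Q1; rewrite (perm_uniq (s2 := [:: i0; i; j; i1])) //.
  by apply/permP => P /=; lia.
move=> h i j l u; have := mem_uniq [tuple h; i; j; l] i0 u.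
rewrite !inE => /or4P[]/eqP eq0; rewrite -eq0 in u *; first exact: Q0.
- move=> /klein; apply: Q0; rewrite (perm_uniq (s2 := [:: h; i0; j; l])) //.
  by apply/permP => P /=; lia.
- move=> /cyc/klein; apply: Q0; rewrite (perm_uniq (s2 := [:: h; i; i0; l])) //.
  by apply/permP => P /=; lia.
- move=> /cyc/cyc/klein; apply: Q0.
  rewrite (perm_uniq (s2 := [:: h; i; j; i0])) //.
  by apply/permP => P /=; lia.
Qed.

(** * A matrix representation detecting products of two generators *)

Section QuadraticRepresentation.

Variables (k : fieldType) (phi : 'I_4 -> 'I_4 -> k).

Let mid (i : 'I_4) : 'I_6 := lift ord0 (lift ord_max i).

(** The representation of the free algebra on k + k^4 + k in which x_i sends the
    first summand to the i-th basis vector, and the basis vectors to the last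
    summand through phi (-, i).  A product of two generators is then a value
    of phi, placed in the corner, so that every quadratic relation annihilated
    by phi holds in this representation. *)
Definition quadratic_mx (i : 'I_4) : 'M[k]_6 :=
  delta_mx ord0 (mid i) + \sum_j phi j i *: delta_mx (mid j) ord_max.

Lemma quadratic_mxM i j :
  quadratic_mx i * quadratic_mx j = phi i j *: delta_mx ord0 ord_max.
Proof.
have mid0 l : (mid l == ord0) = false by rewrite eq_sym (negPf (neq_lift _ _)).
have mid5 l : (mid l == ord_max) = false.
  by apply/negP => /eqP/(congr1 val)/=; rewrite /bump; case: l => l /= ltl; lia.
have midE l m : (mid l == mid m) = (l == m) by rewrite !(inj_eq lift_inj).
rewrite -[LHS]/(_ *m _) {1}/quadratic_mx mulmxDl mulmx_suml.
rewrite [X in _ + X]big1 ?addr0 => [|l _]; last first.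
  rewrite -scalemxAl mulmxDr mul_delta_mx_cond mulr0n add0r mulmx_sumr.
  rewrite big1 ?scaler0 // => m _.
  by rewrite -scalemxAr mul_delta_mx_cond eq_sym mid5 mulr0n scaler0.
rewrite mulmxDr mul_delta_mx_cond mid0 mulr0n add0r mulmx_sumr (bigD1 i) //=.
rewrite -scalemxAr mul_delta_mx_cond eqxx mulr1n big1 ?addr0 // => l /negPf li.
by rewrite -scalemxAr mul_delta_mx_cond midE eq_sym li mulr0n scaler0.
Qed.

Lemma quadratic_mx_commutator i j :
  commutator (quadratic_mx i) (quadratic_mx j) =
  (phi i j - phi j i) *: delta_mx ord0 ord_max.
Proof. by rewrite /commutator !quadratic_mxM -scalerBl. Qed.

Lemma quadratic_mx_anticommutator i j :
  anticommutator (quadratic_mx i) (quadratic_mx j) =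
  (phi i j + phi j i) *: delta_mx ord0 ord_max.
Proof. by rewrite /anticommutator !quadratic_mxM -scalerDl. Qed.

End QuadraticRepresentation.

Section NonVanishing.

Variables (k : fieldType) (a b c : k).
Hypothesis two_neq0 : 2 != 0 :> k.

(** A solution of the relations in which x2 x3, x3 x1 and x1 x2 take the value 2
    and the products in the opposite order take the value 0; the values of
    x0 x_i and x_i x0 are then forced. *)
Definition test_form (i j : 'I_4) : k :=
  nth 0 (nth [::] [:: [:: 0;     1 + a; 1 + b; 1 + c];
                      [:: 1 - a; 0;     2;     0    ];
                      [:: 1 - b; 0;     0;     2    ];
                      [:: 1 - c; 2;     0;     0    ]] i) j.

Lemma satisfies_test_form : satisfies a b c (quadratic_mx test_form).
Proof.
apply/satisfiesP; rewrite !quadratic_mx_commutator !quadratic_mx_anticommutator.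
rewrite !scalerA /test_form /= !subr0 !addr0.
by split; split; congr (_ *: _); ring.
Qed.

(** Both elements act by 2 in the corner of the representation given by
    [test_form]. *)
Lemma gen_products_neq0 i j :
  (i, j) \in [:: (i1, i2); (i2, i3); (i3, i1)] ->
  commutator (gen a b c i) (gen a b c j) != 0 /\
  anticommutator (gen a b c i) (gen a b c j) != 0.
Proof.
have [f fE] := algA_universal satisfies_test_form.
have delta0 : delta_mx ord0 ord_max != 0 :> 'M[k]_6.
  apply/eqP => /matrixP/(_ ord0 ord_max)/eqP.
  by rewrite !mxE !eqxx oner_eq0.
have two0 : 2 *: delta_mx ord0 ord_max != 0 :> 'M[k]_6.
  by rewrite scaler_eq0 negb_or two_neq0.
move=> ij.
have : 2 *: delta_mx ord0 ord_max =
    commutator (quadratic_mx test_form i) (quadratic_mx test_form j) /\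
  2 *: delta_mx ord0 ord_max =
    anticommutator (quadratic_mx test_form i) (quadratic_mx test_form j).
  rewrite quadratic_mx_commutator quadratic_mx_anticommutator.
  move: ij; rewrite !inE => /or3P[]/eqP[-> ->];
    by rewrite /test_form /= subr0 addr0.
case=> comm2 anti2; split; apply: contraNneq two0 => prod0.
  have := etrans (esym (morph_commutator f _ _)) (congr1 f prod0).
  by rewrite rmorph0 !fE -comm2 => ->.
have := etrans (esym (morph_anticommutator f _ _)) (congr1 f prod0).
by rewrite rmorph0 !fE -anti2 => ->.
Qed.

End NonVanishing.

(** * Comparing the parameters *)

(** The commutator of x2 and x3 forces c = 1, and then their anticommutator
    forces a = a'. *)
Lemma pair_relation_unique (k : fieldType) (B : lalgType k) (a a' : k)
    (x0 x1 x2 x3 : B) :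
  commutator x0 x1 = a' *: anticommutator x2 x3 ->
  anticommutator x0 x1 = commutator x2 x3 ->
  commutator x2 x3 != 0 -> anticommutator x2 x3 != 0 ->
  pair_relation a x0 x1 x2 x3 -> a = a'.
Proof.
have scaleI (d e : k) (v : B) : v != 0 -> d *: v = e *: v -> d = e.
  move=> v0 /eqP; rewrite -subr_eq0 -scalerBl scaler_eq0 (negPf v0) orbF.
  by rewrite subr_eq0 => /eqP.
move=> rel rel' comm0 anti0 [c _ []]; rewrite rel rel' => a'E.
rewrite -[LHS]scale1r => /(scaleI _ _ _ comm0) c1.
by move/(scaleI _ _ _ anti0): a'E; rewrite -c1 mulr1.
Qed.

Section ParameterClass.

Lemma cyclic_permutation3P (T : Type) (a b c a' b' c' : T) :
  cyclic_permutation [:: a; b; c] [:: a'; b'; c'] <->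
  [\/ (a', b', c') = (a, b, c), (a', b', c') = (b, c, a)
    | (a', b', c') = (c, a, b)].
Proof.
split=> [[[|[|[|i]]]] | [] [-> -> ->]]; last by exists 2.
- by case=> -> -> ->; constructor 1.
- by case=> -> -> ->; constructor 2.
- by case=> -> -> ->; constructor 3.
- by rewrite rot_oversize // => -[-> -> ->]; constructor 1.
- by exists 0%N.
- by exists 1%N.
Qed.

Variable R : zmodType.
Implicit Types a b c : R.

Definition parameter_class a b c a' b' c' : Prop :=
  cyclic_permutation [:: a; b; c] [:: a'; b'; c'] \/
  cyclic_permutation [:: - a; - c; - b] [:: a'; b'; c'].

Lemma parameter_class_refl a b c : parameter_class a b c a b c.
Proof. by left; exists 0%N. Qed.

Lemma parameter_class_cycle a b c a' b' c' :
  parameter_class a b c a' b' c' -> parameter_class a b c b' c' a'.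
Proof.
move=> [] /cyclic_permutation3P cyc; [left|right]; apply/cyclic_permutation3P.
all: by case: cyc => -[-> -> ->]; [constructor 2|constructor 3|constructor 1].
Qed.

Lemma parameter_class_swap a b c a' b' c' :
  parameter_class a b c a' b' c' -> parameter_class a b c (- a') (- c') (- b').
Proof.
move=> [] /cyclic_permutation3P cyc; [right|left]; apply/cyclic_permutation3P.
all: case: cyc => -[-> -> ->]; rewrite ?opprK.
all: by [constructor 1|constructor 2|constructor 3].
Qed.

End ParameterClass.

Lemma parameter_class_isomorphic (k : fieldType) (a b c a' b' c' : k) :
  parameter_class a b c a' b' c' -> graded_isomorphic a b c a' b' c'.
Proof.
have cyc (d e g d' e' g' : k) :
    cyclic_permutation [:: d; e; g] [:: d'; e'; g'] ->
    graded_isomorphic d e g d' e' g'.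
  move=> /cyclic_permutation3P[] [-> -> ->].
  - exact: graded_isomorphic_refl.
  - exact: graded_isomorphic_cycle.
  - exact: graded_isomorphic_trans (graded_isomorphic_cycle _ _ _)
      (graded_isomorphic_cycle _ _ _).
case=> [/cyc //|/cyc]; apply: graded_isomorphic_trans.
exact: graded_isomorphic_swap.
Qed.

(** Each of the moves generating the permutations of the generators turns the
    relaxed relations for one triple into those for another triple of the same
    class. *)
Lemma quad_relation_reorder (k : fieldType) (B : algType k) (a b c : k)
    (x : 'I_4 -> B) (t : 'I_4 -> 'I_4) :
  injective t -> a * b * c != 0 ->
  quad_relation a b c (x (t i0)) (x (t i1)) (x (t i2)) (x (t i3)) ->
  exists d e g, parameter_class a b c d e g /\
    quad_relation d e g (x i0) (x i1) (x i2) (x i3).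
Proof.
move=> t_inj abc0 rel_t.
pose Q h i j l := exists d e g, [/\ d * e * g != 0,
  parameter_class a b c d e g & quad_relation d e g (x h) (x i) (x j) (x l)].
suff [d [e [g [_ cls rel]]]] : Q i0 i1 i2 i3 by exists d, e, g.
apply: (@order_quadruple Q _ _ _ (t i0) (t i1) (t i2) (t i3)).
- move=> h i j l [d [e [g [deg0 cls rel]]]]; exists (- d), (- g), (- e).
  split; [|exact: parameter_class_swap|exact: quad_relation_swap].
  by rewrite mulrNN mulrN oppr_eq0 mulrAC.
- move=> h i j l [d [e [g [deg0 cls rel]]]]; exists e, g, d.
  split; [|exact: parameter_class_cycle|exact: quad_relation_cycle].
  by rewrite mulrC mulrA.
- move=> h i j l [d [e [g [deg0 cls rel]]]]; exists d, e, g.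
  by split=> //; exact: quad_relation_klein.
- by rewrite -[X in uniq X]/(map t [:: i0; i1; i2; i3]) map_inj_uniq.
by exists a, b, c; split=> //; exact: parameter_class_refl.
Qed.

Lemma quad_relation_rescale (k : fieldType) (B : algType k) (a b c : k)
    (y : 'I_4 -> B) (mu : 'I_4 -> k) :
  (forall i, mu i != 0) -> satisfies a b c y ->
  quad_relation a b c (mu i0 *: y i0) (mu i1 *: y i1)
    (mu i2 *: y i2) (mu i3 *: y i3).
Proof.
by move=> mu0 /satisfiesP[[ra rb rc] [ua ub uc]];
  split; apply: pair_relation_rescale.
Qed.

Lemma quad_relation_gen (k : fieldType) (a b c d e g : k) :
  2 != 0 :> k ->
  quad_relation d e g (gen a b c i0) (gen a b c i1)
    (gen a b c i2) (gen a b c i3) ->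
  [/\ d = a, e = b & g = c].
Proof.
move=> two0 [rd re rg].
have /satisfiesP[[ra rb rc] [ua ub uc]] := @gen_satisfies k a b c.
have nz := @gen_products_neq0 k a b c two0.
have [n23 m23] := nz i2 i3 isT.
have [n31 m31] := nz i3 i1 isT.
have [n12 m12] := nz i1 i2 isT.
split.
- exact: (pair_relation_unique ra ua n23 m23 rd).
- exact: (pair_relation_unique rb ub n31 m31 re).
exact: (pair_relation_unique rc uc n12 m12 rg).
Qed.

Lemma isomorphic_parameter_class (k : fieldType) (a b c a' b' c' : k) :
  2 != 0 :> k -> a * b * c != 0 ->
  graded_isomorphic a b c a' b' c' -> parameter_class a b c a' b' c'.
Proof.
move=> two0 abc0 [f /bij_inj f_inj f_deg].
have f1 i : homogeneous 1 (f (gen a b c i)).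
  exact: (proj1 (f_deg 1%N _) (homogeneous_gen a b c i)).
have [t t_inj [mu mu0 tE]] := injective_degree1_monomial two0 abc0 f_inj f1.
have f_rel := satisfies_morph (f := f) (@gen_satisfies k a b c).
have := quad_relation_rescale mu0 f_rel; rewrite -!tE.
move=> /(quad_relation_reorder t_inj abc0)[d [e [g [cls]]]].
by move=> /(quad_relation_gen two0)[<- <- <-].
Qed.

Theorem proposition2p4 (k : fieldType)
    (char_k : 2%N \notin [pchar k])
    (sqrtN1 : is_square (-1 : k))
    (alpha beta gamma alpha' beta' gamma' : k)
    (sq_alpha : is_square alpha) (sq_beta : is_square beta)
    (sq_gamma : is_square gamma)
    (sq_alpha' : is_square alpha') (sq_beta' : is_square beta')
    (sq_gamma' : is_square gamma')
    (nz : alpha * beta * gamma != 0)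
    (nz' : alpha' * beta' * gamma' != 0) :
  graded_isomorphic alpha beta gamma alpha' beta' gamma' <->
  cyclic_permutation [:: alpha; beta; gamma] [:: alpha'; beta'; gamma'] \/
  cyclic_permutation [:: - alpha; - gamma; - beta] [:: alpha'; beta'; gamma'].
Proof.
have two0 : 2 != 0 :> k by move: char_k; rewrite inE.
split; first exact: isomorphic_parameter_class.
exact: parameter_class_isomorphic.
Qed.
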